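(* A functional extension ${}^{*}X$ of a set $X$ satisfies simultaneously the principles Ind and Tran if and only if all the ultrafilters $\mathcal{U}_{\xi}=\{A\subseteq X\mid \xi\in{}^{*}A\}$ on $X$ associated to the points $\xi\in{}^{*}X$ are Hausdorff.
   Context: Convention: $X$ is a set with two distinct distinguished elements $0,1\in X$; characteristic functions take values in $\{0,1\}$, and so are regarded as functions into $X$ (or into a superset of $X$). Functional extension: a functional extension of $X$ is a proper superset ${}^{*}X\supsetneq X$ together with, for each function $f:X\to X$, a distinguished extension ${}^{*}f:{}^{*}X\to{}^{*}X$ of $f$ (so ${}^{*}f(x)=f(x)$ for $x\in X$), such that: (comp) ${}^{*}(g\circ f)={}^{*}g\circ{}^{*}f$ for all $f,g:X\to X$; (equ) ${}^{*}(\chi_{fg})=\chi_{{}^{*}f\,{}^{*}g}$ for all $f,g:X\to X$, where for two functions $\phi,\psi$ with common domain, $\chi_{\phi\psi}(z)=1$ if $\phi(z)=\psi(z)$ and $\chi_{\phi\psi}(z)=0$ otherwise; (dir) for all $\xi,\eta\in{}^{*}X$ there exist $p_1,p_2:X\to X$ and $\zeta\in{}^{*}X$ such that $\xi={}^{*}p_1(\zeta)$ and $\eta={}^{*}p_2(\zeta)$. Extension of $n$-ary functions and relations in a functional extension: for all $\xi_1,\dots,\xi_n\in{}^{*}X$ there exist $p_1,\dots,p_n:X\to X$ and $\zeta\in{}^{*}X$ with ${}^{*}p_i(\zeta)=\xi_i$. For $F:X^n\to X$ one sets ${}^{*}F(\xi_1,\dots,\xi_n)={}^{*}(F\circ(p_1,\dots,p_n))(\zeta)$,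 which is independent of the choice of the $p_i$ and $\zeta$. For an $n$-ary relation $R\subseteq X^n$ with characteristic function $\chi_R:X^n\to X$, one sets ${}^{*}R=\{(\xi_1,\dots,\xi_n)\in({}^{*}X)^n\mid{}^{*}\chi_R(\xi_1,\dots,\xi_n)=1\}$. In particular, for $A\subseteq X$, ${}^{*}A=\{\xi\in{}^{*}X\mid{}^{*}\chi_A(\xi)=1\}$; the map $A\mapsto{}^{*}A$ is a Boolean isomorphism from $\mathcal{P}(X)$ onto a field of subsets of ${}^{*}X$, so each $\mathcal{U}_\xi$ is an ultrafilter on $X$. Ind: different elements of ${}^{*}X$ are separated by the extension of some property of $X$, i.e. for all $\xi\neq\eta$ in ${}^{*}X$ there exists $A\subseteq X$ with $\xi\in{}^{*}A$ and $\eta\notin{}^{*}A$. Tran: for every first-order sentence $\varphi$ in the language having a symbol for each element of $X$, each finitary function $X^n\to X$ and each finitary relation on $X$, $\varphi$ is true in $X$ if and only if it is true in ${}^{*}X$ when each element of $X$ is interpreted as itself, each function $F$ as ${}^{*}F$ and each relation $R$ as ${}^{*}R$. Hausdorff ultrafilter: for an ultrafilter $\mathcal{U}$ on $X$ and $f:X\to X$, let $\overline{f}(\mathcal{U})=\{A\subseteq X\mid f^{-1}(A)\in\mathcal{U}\}$. The ultrafilter $\mathcal{U}$ is called Hausdorff if for all $f,g:X\to X$: $\overline{f}(\mathcal{U})=\overline{g}(\mathcal{U})$ if and only if $\{x\in X\mid f(x)=g(x)\}\in\mathcal{U}$. *)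

(* Defs.v *)
From mathcomp Require Import all_boot.
From mathcomp Require Import boolp classical_sets functions filter.

Set Implicit Arguments.
Unset Strict Implicit.
Unset Printing Implicit Defensive.

Local Open Scope classical_set_scope.

Definition chi (T Z : Type) (z0 z1 : Z) (A : set T) : T -> Z :=
  fun x => if `[< A x >] then z1 else z0.

Definition chi_eq (T Y Z : Type) (z0 z1 : Z) (phi psi : T -> Y) : T -> Z :=
  chi z0 z1 [set z | phi z = psi z].

Lemma chiT (T Z : Type) (z0 z1 : Z) (A : set T) x : A x -> chi z0 z1 A x = z1.
Proof. by rewrite /chi; case: asboolP. Qed.

Lemma chiF (T Z : Type) (z0 z1 : Z) (A : set T) x : ~ A x -> chi z0 z1 A x = z0.
Proof. by rewrite /chi; case: asboolP. Qed.

(* The inclusion of X into its proper superset is rendered as an injective,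
   non-surjective map [emb]; [x0] and [x1] are the distinguished elements
   0 and 1 of X. *)
Record functional_extension (X : Type) (x0 x1 : X) := FunctionalExtension {
  ext :> Type;
  emb : X -> ext;
  star : (X -> X) -> (ext -> ext);
  emb_inj : injective emb;
  emb_proper : exists xi : ext, forall x : X, emb x <> xi;
  star_emb : forall (f : X -> X) (x : X), star f (emb x) = emb (f x);
  star_comp : forall f g : X -> X, star (g \o f) = star g \o star f;
  star_equ : forall f g : X -> X,
    star (chi_eq x0 x1 f g) = chi_eq (emb x0) (emb x1) (star f) (star g);
  star_dir : forall xi eta : ext, exists (p1 p2 : X -> X) (zeta : ext),
    xi = star p1 zeta /\ eta = star p2 zeta
}.

Arguments emb {X x0 x1} sX _ : rename.
Arguments star {X x0 x1} sX _ _ : rename.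

(* X^n is represented by 'I_n -> X. *)
Definition represents (X : Type) (x0 x1 : X) (sX : functional_extension x0 x1)
    (n : nat) (xi : 'I_n -> sX) (pz : ('I_n -> X -> X) * sX) : Prop :=
  forall i, star sX (pz.1 i) pz.2 = xi i.

Lemma represents_ex (X : Type) (x0 x1 : X) (sX : functional_extension x0 x1)
    (n : nat) (xi : 'I_n -> sX) : exists pz, represents xi pz.
Proof.
elim: n xi => [|n IHn] xi.
  by exists (fun=> id, emb sX x0) => -[].
have [[p z] /= Hp] := IHn (fun i => xi (lift ord0 i)).
have [q1 [q2 [w [xi0 zE]]]] := star_dir (xi ord0) z.
exists (fun i => if unlift ord0 i is Some j then p j \o q2 else q1, w).
move=> i /=; case: unliftP => [j|] ->; last by rewrite xi0.
by rewrite star_comp /= -zE; exact: Hp.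
Qed.

(* The choice of representatives is immaterial, see [star_funE]. *)
Definition star_fun (X : Type) (x0 x1 : X) (sX : functional_extension x0 x1)
    (n : nat) (F : ('I_n -> X) -> X) (xi : 'I_n -> sX) : sX :=
  let pz := projT1 (cid (represents_ex xi)) in
  star sX (fun x => F (fun i => pz.1 i x)) pz.2.

Definition star_rel (X : Type) (x0 x1 : X) (sX : functional_extension x0 x1)
    (n : nat) (R : set ('I_n -> X)) : set ('I_n -> sX) :=
  [set xi | star_fun (chi x0 x1 R) xi = emb sX x1].

Definition star_set (X : Type) (x0 x1 : X) (sX : functional_extension x0 x1)
    (A : set X) : set sX :=
  [set xi | star sX (chi x0 x1 A) xi = emb sX x1].

Arguments star_set {X x0 x1} sX A _ : rename.

Definition ultra_of (X : Type) (x0 x1 : X) (sX : functional_extension x0 x1)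
    (xi : sX) : set_system X :=
  [set A | star_set sX A xi].

Definition hausdorff_ultrafilter (X : Type) (U : set_system X) : Prop :=
  UltraFilter U /\
  forall f g : X -> X, fmap f U = fmap g U <-> U [set x | f x = g x].

Definition Ind (X : Type) (x0 x1 : X) (sX : functional_extension x0 x1) : Prop :=
  forall xi eta : sX, xi <> eta ->
    exists A : set X, star_set sX A xi /\ ~ star_set sX A eta.

(* First-order logic with equality over the language having a symbol for each
   element of X, each function X^n -> X and each n-ary relation on X. Terms and
   formulas are indexed by the type V of their free variables, a quantifier
   binding the variable [None : option V]. *)
Inductive term (X V : Type) : Type :=
| Var of V
| Cst of X
| App (n : nat) of (('I_n -> X) -> X) & ('I_n -> term X V).

Inductive formula (X V : Type) : Type :=
| Eq of term X V & term X V
| Rel (n : nat) of set ('I_n -> X) & ('I_n -> term X V)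
| Not of formula X V
| And of formula X V & formula X V
| Or of formula X V & formula X V
| Imp of formula X V & formula X V
| All of formula X (option V)
| Exi of formula X (option V).

Definition sentence (X : Type) : Type := formula X void.

Record structure (X : Type) := Structure {
  carrier :> Type;
  i_cst : X -> carrier;
  i_fun : forall n, (('I_n -> X) -> X) -> ('I_n -> carrier) -> carrier;
  i_rel : forall n, set ('I_n -> X) -> set ('I_n -> carrier)
}.

Fixpoint eval (X V : Type) (M : structure X) (e : V -> M) (t : term X V) : M :=
  match t with
  | Var v => e v
  | Cst x => i_cst M x
  | App n F ts => i_fun F (fun i => eval e (ts i))
  end.

Fixpoint holds (X V : Type) (M : structure X) (e : V -> M) (phi : formula X V)
    : Prop :=
  match phi with
  | Eq t u => eval e t = eval e u
  | Rel n R ts => i_rel R (fun i => eval e (ts i))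
  | Not p => ~ holds e p
  | And p q => holds e p /\ holds e q
  | Or p q => holds e p \/ holds e q
  | Imp p q => holds e p -> holds e q
  | All p => forall a : M, holds (oapp e a) p
  | Exi p => exists a : M, holds (oapp e a) p
  end.

Definition true_in (X : Type) (M : structure X) (phi : sentence X) : Prop :=
  holds (@of_void M) phi.

Definition std_structure (X : Type) : structure X :=
  @Structure X X id (fun _ F => F) (fun _ R => R).

Definition star_structure (X : Type) (x0 x1 : X)
    (sX : functional_extension x0 x1) : structure X :=
  @Structure X sX (emb sX) (fun _ F => star_fun F) (fun _ R => star_rel R).

Definition Tran (X : Type) (x0 x1 : X) (sX : functional_extension x0 x1) : Prop :=
  forall phi : sentence X,
    true_in (std_structure X) phi <-> true_in (star_structure sX) phi.

Section Independence.
Context (X : Type) (x0 x1 : X) (x01 : x0 <> x1) (sX : functional_extension x0 x1).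
Implicit Types (A B : set X) (z : sX).

Let emb01 : emb sX x0 <> emb sX x1.
Proof. by move=> /(@emb_inj _ _ _ sX). Qed.

Lemma star_cst (c : X) z : star sX (fun=> c) z = emb sX c.
Proof.
rewrite -[LHS]/(star sX ((fun=> c) \o chi_eq x0 x1 id id) z) star_comp /=.
have -> : star sX (chi_eq x0 x1 id id) z = emb sX x1.
  by rewrite star_equ /chi_eq chiT.
by rewrite star_emb.
Qed.

Lemma ultra_of_eq (f g : X -> X) z :
  ultra_of z [set x | f x = g x] <-> star sX f z = star sX g z.
Proof.
rewrite /ultra_of /star_set /= -[chi _ _ _]/(chi_eq x0 x1 f g) star_equ.
split=> [H|H]; last by rewrite /chi_eq chiT.
by apply: contrapT => nH; apply: emb01; rewrite -H /chi_eq chiF.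
Qed.

Lemma star_chi0 A z : ~ ultra_of z A -> star sX (chi x0 x1 A) z = emb sX x0.
Proof.
have -> : chi x0 x1 A = chi_eq x0 x1 (chi x0 x1 A) (fun=> x1).
  apply/funext => x; rewrite /chi_eq.
  have [Ax|nAx] := pselect (A x); first by rewrite !chiT //= chiT.
  by rewrite !chiF //= chiF.
move=> H; rewrite star_equ /chi_eq chiF //= star_cst => E; apply: H.
by rewrite /ultra_of /star_set /=; rewrite -[RHS]E.
Qed.

Lemma ultra_of_setC A z : ~ ultra_of z A -> ultra_of z (~` A).
Proof.
move/star_chi0 => H; have : star sX (chi x0 x1 A) z = star sX (fun=> x0) z.
  by rewrite star_cst.
move/ultra_of_eq; congr (ultra_of _ _); apply/seteqP; split => x /= Hx.
  by move=> Ax; apply: x01; rewrite -Hx chiT.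
by rewrite chiF.
Qed.

Lemma third_element : exists x2 : X, x2 <> x0 /\ x2 <> x1.
Proof.
apply: contrapT => H2; have [xi xiP] := emb_proper sX.
have all01 x : x = x0 \/ x = x1.
  by apply: contrapT => /not_orP H; apply: H2; exists x.
have idE : id = chi_eq x0 x1 id (fun=> x1).
  apply/funext => x; have [->|->] := all01 x; first by rewrite /chi_eq chiF.
  by rewrite /chi_eq chiT.
have [p [_ [z [xiE _]]]] := star_dir xi xi.
have : star sX id xi = xi 
  by rewrite {1}xiE -[LHS]/((star sX id \o star sX p) z) -star_comp xiE.
rewrite idE star_equ /chi_eq /chi; case: `[< _ >]; exact: xiP.
Qed.

Lemma ultra_of_disj A B z :
  (forall x, A x -> B x -> False) -> ultra_of z A -> ultra_of z B -> False.
Proof.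
move=> AB; have [x2 [x20 x21]] := third_element.
pose m x := if `[< A x >] then x1 else if `[< B x >] then x0 else x2.
have -> : A = [set x | m x = x1].
  by apply/seteqP; split => x /=; rewrite /m; do ?case: asboolP.
have -> : B = [set x | m x = x0].
  apply/seteqP; split => x /=; rewrite /m; case: asboolP => //.
  - by move=> Ax /(AB _ Ax).
  - by move=> nA; case: asboolP.
  - by move=> _ /esym/x01.
  - by move=> nA; case: asboolP.
by move=> /ultra_of_eq + /ultra_of_eq; rewrite !star_cst => -> /esym/emb01.
Qed.

Lemma ultra_ofS A B z : A `<=` B -> ultra_of z A -> ultra_of z B.
Proof.
move=> AB zA; apply: contrapT => /ultra_of_setC.
by apply: (ultra_of_disj _ zA) => x /AB.
Qed.

Lemma ultra_ofI A B z : ultra_of z A -> ultra_of z B -> ultra_of z (A `&` B).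
Proof.
move=> zA zB; have nA : ~ ultra_of z (~` A).
  by apply: (ultra_of_disj _ zA) => x Ax; apply.
have nAB : ~ ultra_of z (A `\` B).
  by apply: (ultra_of_disj _ zB) => x Bx [_]; apply.
have /ultra_of_eq : star sX (chi x0 x1 (~` A)) z = star sX (chi x0 x1 (A `\` B)) z.
  by rewrite !star_chi0.
apply: ultra_ofS => x /= E; have [Ax|nAx] := pselect (A x); last first.
  by case: x01; move: E; rewrite chiT // chiF // => -[].
have [//|nBx] := pselect (B x).
by case: x01; move: E; rewrite chiF ?chiT // => /(_ Ax).
Qed.

Lemma ultra_of_forall (n : nat) (A : 'I_n -> set X) z :
  (forall i, ultra_of z (A i)) -> ultra_of z [set x | forall i, A i x].
Proof.
elim: n A => [|n IHn] A zA.
  have := star_cst x1 z; rewrite /ultra_of /star_set /=.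
  by congr (star sX _ _ = _); apply/funext => x; rewrite /chi; case: asboolP => // -[] [].
have := ultra_ofI (zA ord0) (IHn _ (fun i => zA (lift ord0 i))).
by apply: ultra_ofS => x [A0 AS] i; case: (unliftP ord0 i) => [j|] ->.
Qed.

Lemma represents_star_eq (n : nat) (F : ('I_n -> X) -> X) (xi : 'I_n -> sX) pz qw :
  represents xi pz -> represents xi qw ->
  star sX (fun x => F (fun i => pz.1 i x)) pz.2 =
  star sX (fun x => F (fun i => qw.1 i x)) qw.2.
Proof.
case: pz qw => [p z] [q w]; rewrite /represents /= => Hp Hq.
have [r [s [t [zE wE]]]] := star_dir z w; rewrite zE wE.
rewrite -[LHS]/((star sX _ \o star sX r) t) -[RHS]/((star sX _ \o star sX s) t).
rewrite -(star_comp sX r) -(star_comp sX s); apply/ultra_of_eq.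
have : ultra_of t [set x | forall i, (p i \o r) x = (q i \o s) x].
  apply: (@ultra_of_forall _ (fun i => [set x | (p i \o r) x = (q i \o s) x])).
  by move=> i; apply/ultra_of_eq; rewrite (star_comp sX r) (star_comp sX s) /= -zE -wE Hp Hq.
by apply: ultra_ofS => x /= H; congr F; apply/funext.
Qed.

End Independence.

Lemma star_funE (X : Type) (x0 x1 : X) (x01 : x0 <> x1)
    (sX : functional_extension x0 x1) (n : nat) (F : ('I_n -> X) -> X)
    (xi : 'I_n -> sX) (p : 'I_n -> X -> X) (zeta : sX) :
  (forall i, star sX (p i) zeta = xi i) ->
  star_fun F xi = star sX (fun x => F (fun i => p i x)) zeta.
Proof.
move=> H; rewrite /star_fun; case: cid => pz /= Hpz.
exact: (represents_star_eq x01 F Hpz (qw := (p, zeta))).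
Qed.

(* Main.v *)
Require Import Defs.
From mathcomp Require Import all_boot.
From mathcomp Require Import boolp classical_sets functions filter.

(** The star extension sends [f] to an image of ultrafilters, and by (dir) any two
    points are of the form [star p zeta], [star q zeta]. Hence Ind says that
    [star p zeta] and [star q zeta] agree as soon as the images of [ultra_of zeta]
    under [p] and [q] do, which is the Hausdorff property of [ultra_of zeta].
    Tran holds in every functional extension: by (dir), Łoś's theorem for
    the ultrapowers given by the subsets [{star p zeta | p : X -> X}] goes
    through in the whole of [ext] simultaneously. *)

Set Implicit Arguments.
Unset Strict Implicit.
Unset Printing Implicit Defensive.

Local Open Scope classical_set_scope.

(** Under a quantifier, this turns the extended family of representing functions, taken at [x], into
    the extended valuation in [X]. *)
Lemma oapp_swap (V S T : Type) (p : V -> S -> T) (q : S -> T) (x : S) :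
  (oapp p q)^~ x = oapp (p^~ x) (q x).
Proof. by apply/funext => -[]. Qed.

Section FunctionalExtension.
Context (X : Type) (x0 x1 : X) (x01 : x0 <> x1) (sX : functional_extension x0 x1).
Implicit Types (A B : set X) (z : sX).

Local Notation stdX := (std_structure X).

Lemma ultra_of_star (f : X -> X) z : ultra_of (star sX f z) = fmap f (ultra_of z).
Proof.
apply/seteqP; split=> A; rewrite /ultra_of /fmap /star_set /=;
  by rewrite -[star sX (chi x0 x1 A) _]/((star sX _ \o star sX f) z) -star_comp.
Qed.

Lemma ultra_of_preimage (f : X -> X) A z :
  ultra_of (star sX f z) A <-> ultra_of z (f @^-1` A).
Proof. by rewrite ultra_of_star. Qed.

Lemma ultra_ofT z : ultra_of z setT.
Proof.
have -> : setT = [set x : X | id x = id x] by apply/seteqP.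
exact/(ultra_of_eq x01).
Qed.

Lemma ultra_of_not A z : ultra_of z (~` A) <-> ~ ultra_of z A.
Proof.
split=> [zA|]; last exact: ultra_of_setC.
by apply: (ultra_of_disj x01 _ zA) => x; apply.
Qed.

Lemma ultra_of_and A B z : ultra_of z (A `&` B) <-> ultra_of z A /\ ultra_of z B.
Proof.
split=> [zAB|[zA zB]]; last exact: ultra_ofI.
by split; apply: (ultra_ofS x01 _ zAB) => x [].
Qed.

Lemma ultra_of_imp A B z :
  ultra_of z [set x | A x -> B x] <-> (ultra_of z A -> ultra_of z B).
Proof.
split=> [zAB zA|zAB].
  by apply: (ultra_ofS x01 _ (ultra_ofI x01 zAB zA)) => x [/[apply]].
have [/zAB|/(ultra_of_setC x01)] := pselect (ultra_of z A);
  by apply: (ultra_ofS x01) => x //= nAx /nAx.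
Qed.

Lemma ultra_of_or A B z : ultra_of z (A `|` B) <-> ultra_of z A \/ ultra_of z B.
Proof.
split=> [zAB|[]]; last 2 first.
- by apply: (ultra_ofS x01) => x; left.
- by apply: (ultra_ofS x01) => x; right.
have [|/ultra_of_not zA] := pselect (ultra_of z A); first by left.
by right; apply: (ultra_ofS x01 _ (ultra_ofI x01 zAB zA)) => x [[]].
Qed.

Lemma ultra_of_emb A (x : X) : ultra_of (emb sX x) A <-> A x.
Proof.
rewrite /ultra_of /star_set /= star_emb; split=> [/(@emb_inj _ _ _ sX)|Ax].
  by rewrite /chi; case: asboolP.
by rewrite chiT.
Qed.

Lemma ultra_of_ultrafilter z : UltraFilter (ultra_of z).
Proof.
have ultra_filter : ProperFilter (ultra_of z).
  split.
    move=> z0; apply: (ultra_of_disj x01 _ z0 (ultra_ofT z)).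
    by move=> x.
  split; first exact: ultra_ofT.
    by move=> A B; exact: ultra_ofI.
  by move=> A B; exact: ultra_ofS.
split=> // G GF zG; apply/seteqP; split=> // A GA.
apply: contrapT => /(ultra_of_setC x01)/zG GnA.
by apply: (@filter_not_empty _ G); rewrite -(setICr A); exact: filterI.
Qed.

(** Once all variables are represented over one point [z], so are all subterms, and [star_fun] can
    be computed from these representatives. *)
Lemma eval_star (V : Type) (p : V -> X -> X) (e : V -> sX) z (t : term X V) :
  (forall v, star sX (p v) z = e v) ->
  eval (M := star_structure sX) e t =
  star sX (fun x => eval (M := stdX) (p^~ x) t) z.
Proof.
move=> pe; elim: t => [v|c|n F ts IHts] /=; first by rewrite pe.
- by rewrite star_cst.
- by apply: (star_funE x01) => i; rewrite IHts.
Qed.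

Lemma oapp_star (V : Type) (p : V -> X -> X) (e : V -> sX) (q : X -> X) z xi :
  (forall v, star sX (p v) z = e v) -> xi = star sX q z ->
  forall v, star sX (oapp p q v) z = oapp e xi v.
Proof. by move=> pe -> [v|] /=. Qed.

(** Connectives follow from the ultrafilter laws. The induction keeps [z] general, since a
    quantified point may force a change of base point. *)
Lemma los (V : Type) (phi : formula X V) (p : V -> X -> X) (e : V -> sX) z :
  (forall v, star sX (p v) z = e v) ->
  holds (M := star_structure sX) e phi <->
  ultra_of z [set x | holds (M := stdX) (p^~ x) phi].
Proof.
elim: phi p e z => {V} [V t u|V n R ts|V a IHa|V a IHa b IHb|V a IHa b IHb
  |V a IHa b IHb|V a IHa|V a IHa] p e z pe /=.
- by rewrite !(eval_star _ pe) (ultra_of_eq x01).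
- rewrite /star_rel /=.
  by rewrite (star_funE x01 _ (fun i => esym (eval_star (ts i) pe))).
- by rewrite (IHa _ _ _ pe) -ultra_of_not.
- by rewrite (IHa _ _ _ pe) (IHb _ _ _ pe) -ultra_of_and.
- by rewrite (IHa _ _ _ pe) (IHb _ _ _ pe) -ultra_of_or.
- by rewrite (IHa _ _ _ pe) (IHb _ _ _ pe) -ultra_of_imp.
- split=> [ea|za xi].
  (* [q x] is a counterexample to [a] at [x] if there is one, so the single instance [star sX q z]
     decides the universal formula. *)
  + have /choice[q qP] x : exists b : X,
        holds (M := stdX) (oapp (p^~ x) b) a ->
        forall c, holds (M := stdX) (oapp (p^~ x) c) a.
      have [|/existsNP[b nb]] :=
        pselect (forall c, holds (M := stdX) (oapp (p^~ x) c) a).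
        by exists x0.
      by exists b.
    have /(IHa (oapp p q) _ z) := ea (star sX q z).
    move=> /(_ (oapp_star pe (erefl _))); apply: (ultra_ofS x01) => x /=.
    by rewrite oapp_swap; exact: qP.
  (* [xi] need not be of the form [star sX q z]; by (dir), both points are pulled back to a common
     [t]. *)
  + have [s [q [t [zE xiE]]]] := star_dir z xi.
    apply/(IHa (oapp (fun v => p v \o s) q) _ t).
      by apply: oapp_star => // v; rewrite star_comp /= -zE.
    move: za; rewrite zE ultra_of_preimage; apply: (ultra_ofS x01) => x /= ax.
    by rewrite oapp_swap; exact: ax.
- split=> [[xi ea]|za].
  + have [s [q [t [zE xiE]]]] := star_dir z xi.
    move/(IHa (oapp (fun v => p v \o s) q) _ t): ea.
    rewrite zE ultra_of_preimage => ea.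
    apply: (ultra_ofS x01 _ (ea _)) => [x /=|].
      by rewrite oapp_swap => ax; exists (q x).
    by apply: oapp_star => // v; rewrite star_comp /= -zE.
  (* [q] is a Skolem function, with default value [x0]. *)
  + have /choice[q qP] x : exists b : X,
        (exists c, holds (M := stdX) (oapp (p^~ x) c) a) ->
        holds (M := stdX) (oapp (p^~ x) b) a.
      have [[b ab]|] :=
        pselect (exists c, holds (M := stdX) (oapp (p^~ x) c) a).
        by exists b.
      by exists x0.
    exists (star sX q z).
    apply/(IHa (oapp p q) _ z); first exact: oapp_star.
    by apply: (ultra_ofS x01 _ za) => x /= /qP; rewrite oapp_swap.
Qed.

Lemma transfer : Tran sX.
Proof.
move=> phi; rewrite /true_in.
(* Without free variables any base point serves; at [emb sX x0] the ultrafilter is principal. *)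
rewrite (@los _ phi (fun v _ => of_void X v) _ (emb sX x0)); last by case.
by rewrite ultra_of_emb.
Qed.

End FunctionalExtension.

Theorem theorem2p4 (X : Type) (x0 x1 : X) (x01 : x0 <> x1)
    (sX : functional_extension x0 x1) :
  (Ind sX /\ Tran sX) <->
  (forall xi : sX, hausdorff_ultrafilter (ultra_of xi)).
Proof.
split=> [[ind _] xi|haus].
  split=> [|f g]; first exact: ultra_of_ultrafilter.
  rewrite (ultra_of_eq x01) -!ultra_of_star; split=> [fgE|-> //].
  apply: contrapT => /ind[A [fA gA]]; apply: gA.
  by rewrite -[star_set _ _ _]/(ultra_of _ _) -fgE.
split; last exact: transfer.
move=> xi eta; have [p [q [z [-> ->]]]] := star_dir xi eta => pq.
apply: contrapT => sep; apply: pq.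
apply/(ultra_of_eq x01)/(haus z).2; rewrite -!ultra_of_star.
apply/seteqP; split=> A.
  by move=> pA; apply: contrapT => qA; apply: sep; exists A.
(* Ind separates in one direction only, so here the complement is used. *)
move=> qA; apply: contrapT => pA; apply: sep; exists (~` A); split.
  exact: ultra_of_setC.
by move/(ultra_of_not x01).
Qed.
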